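(* Let $\mathcal{X}$ be an infinite-dimensional type $1$ normed space over $\mathbb{F}$ and let $T\in\mathcal{B}[\mathcal{X}]$ be a power bounded operator such that, for every nonzero $x\in\mathcal{X}$, the sequence $\{T^nx\}_{n\ge0}$ does not converge weakly to $0$. Then either (i) $T$ has no weakly l-sequentially supercyclic vector, or (ii) if $y\in\mathcal{X}$ is a weakly l-sequentially supercyclic vector for $T$, then every nonzero $f\in\mathcal{X}^*$ for which $f(T^ny)\not\to0$ is such that either $$\liminf_n|f(T^ny)|=0,$$ or $$\limsup_k|f(T^{n_k}y)|<\|f\|\,\limsup_k\|T^{n_k}y\|$$ for some subsequence $\{T^{n_k}\}_{k\ge0}$ of $\{T^n\}_{n\ge0}$.
   Context: $\mathbb{F}$ is either $\mathbb{R}$ or $\mathbb{C}$. $\mathcal{B}[\mathcal{X}]$ is the normed algebra of all operators (bounded linear maps) of $\mathcal{X}$ into itself, and $\mathcal{X}^*$ is the dual of $\mathcal{X}$. $T$ is power bounded if $\sup_{n\ge0}\|T^n\|<\infty$. A normed space $\mathcal{X}$ is of type $1$ (a Radon–Riesz space) if, for every $\mathcal{X}$-valued sequence $\{x_k\}_{k\ge0}$ and every $x\in\mathcal{X}$, $x_k\to x$ in norm if and only if $x_k\to x$ weakly and $\|x_k\|\to\|x\|$. A nonzero vector $y\in\mathcal{X}$ is a weakly l-sequentially supercyclic vector for $T$ if for every $x\in\mathcal{X}$ there exist a sequence $\{\alpha_k\}_{k\ge0}$ of nonzero numbers in $\mathbb{F}$ and a subsequence $\{T^{n_k}\}_{k\ge0}$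 of $\{T^n\}_{n\ge0}$ (both depending on $x$ and $y$) such that $\alpha_kT^{n_k}y$ converges weakly to $x$. *)

(* Defs.v *)
From Stdlib Require Export Reals.
From Coquelicot Require Export Coquelicot.
Open Scope R_scope.

(* Coquelicot's [is_linear] includes boundedness, so [is_linear T] for
   [T : X -> X] says that [T] is in B[X], and [is_functional f] that [f] is in
   the (topological) dual of [X]. *)

Definition is_R_or_C (F : AbsRing) : Prop := F = R_AbsRing \/ F = C_AbsRing.

Definition is_functional {F : AbsRing} {X : NormedModule F} (f : X -> F) : Prop :=
  @is_linear F X (AbsRing_NormedModule F) f.

(* [sum_n u n] has the [n + 1] terms [u 0, ..., u n]; this is harmless here
   since a spanning family may be padded. *)
Definition finite_dimensional {F : AbsRing} (X : NormedModule F) : Prop :=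
  exists (n : nat) (e : nat -> X), forall x : X,
  exists c : nat -> F, x = sum_n (fun i => scal (c i) (e i)) n.

Definition infinite_dimensional {F : AbsRing} (X : NormedModule F) : Prop :=
  ~ finite_dimensional X.

Definition op_norm {F : AbsRing} {U V : NormedModule F} (l : U -> V) : Rbar :=
  Lub_Rbar (fun r => exists x : U, norm x <= 1 /\ r = norm (l x)).

Definition dual_norm {F : AbsRing} {X : NormedModule F} (f : X -> F) : Rbar :=
  @op_norm F X (AbsRing_NormedModule F) f.

Definition power_bounded {F : AbsRing} {X : NormedModule F} (T : X -> X) : Prop :=
  Rbar_lt (Sup_seq (fun n => op_norm (Nat.iter n T))) p_infty.

Definition norm_cvg {F : AbsRing} {X : NormedModule F} (x : nat -> X) (l : X) : Prop :=
  filterlim x eventually (locally l).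

Definition weak_cvg {F : AbsRing} {X : NormedModule F} (x : nat -> X) (l : X) : Prop :=
  forall f : X -> F, is_functional f ->
  filterlim (fun k => f (x k)) eventually (locally (f l)).

Definition type1 {F : AbsRing} (X : NormedModule F) : Prop :=
  forall (x : nat -> X) (l : X),
  norm_cvg x l <->
  (weak_cvg x l /\ is_lim_seq (fun k => norm (x k)) (norm l)).

Definition strictly_increasing (n : nat -> nat) : Prop :=
  forall k : nat, (n k < n (S k))%nat.

Definition weakly_l_seq_supercyclic {F : AbsRing} {X : NormedModule F}
    (T : X -> X) (y : X) : Prop :=
  y <> zero /\
  forall x : X, exists (alpha : nat -> F) (n : nat -> nat),
    (forall k, alpha k <> zero) /\
    strictly_increasing n /\
    weak_cvg (fun k => scal (alpha k) (Nat.iter (n k) T y)) x.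

(* Main.v *)
Require Import Defs.
From Stdlib Require Import Lra Lia.

(** The first alternative on [f] always holds: along the orbit of a weakly
    l-sequentially supercyclic vector [y], the lower limit of [|f (T^n y)|] is
    zero, for every functional [f].

    Suppose instead that [c <= |f (T^n y)|] for all large [n], with [c > 0].
    Since the orbit is bounded, any functional [g] satisfies
    [|g (T^n y)| <= K <= (K / c) |f (T^n y)|] for all large [n]. This inequality
    is homogeneous, so it also holds for the vectors [alpha_k T^{n_k} y], and it
    passes to their weak limits, that is, to all vectors
    ([functional_dominated]): [|g x| <= C |f x|] for every [x]. Hence a vector
    killed by [f] is killed by the whole dual, so it is zero, and then [X] is
    spanned by a single vector because [f] is injective. This contradicts
    infinite dimension.

    That the dual separates points usually comes from the Hahn-Banach theorem.
    Here the type 1 hypothesis gives it directly ([type1_separates_points]): if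
    every functional vanishes at [x], then the constant sequence [x] converges
    weakly to [-x], with the same norm, hence in norm, so that [x = -x]. *)

(** * Scalars *)

Lemma abs_mult_R_or_C (F : AbsRing) (HF : is_R_or_C F) (a b : F) :
  abs (mult a b) = abs a * abs b.
Proof.
  destruct HF as [-> | ->]; [exact (Rabs_mult a b) | exact (Cmod_mult a b)].
Qed.

Lemma left_inverse_R_or_C (F : AbsRing) (HF : is_R_or_C F) (a : F) :
  a <> zero -> exists b : F, mult b a = one.
Proof.
  destruct HF as [-> | ->]; intros Ha.
  - exists (/ a). exact (Rinv_l a Ha).
  - exists (Cinv a). exact (Cinv_l a Ha).
Qed.

Lemma two_neq_zero_R_or_C (F : AbsRing) (HF : is_R_or_C F) :
  plus one one <> (zero : F).
Proof.
  destruct HF as [-> | ->]; intros H.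
  - change (1 + 1 = 0) in H. lra.
  - apply (f_equal fst) in H. change (1 + 1 = 0) in H. lra.
Qed.

(** Rescaling into the unit ball, where [op_norm] controls an operator, needs
    invertible scalars of small absolute value; a general [AbsRing] may have
    none. *)
Lemma small_invertible_R_or_C (F : AbsRing) (HF : is_R_or_C F) (r : R) :
  0 < r -> exists a b : F, abs b = r /\ mult a b = one.
Proof.
  intros Hr. destruct HF as [-> | ->].
  - exists (/ r), r. split.
    + exact (Rabs_pos_eq r (Rlt_le _ _ Hr)).
    + apply (Rinv_l r). lra.
  - exists (Cinv (RtoC r)), (RtoC r). split.
    + change (Cmod (RtoC r) = r). rewrite Cmod_R. apply Rabs_pos_eq. lra.
    + apply (Cinv_l (RtoC r)). intros H. apply (f_equal fst) in H.
      simpl in H. lra.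
Qed.

(** * Lower limits of nonnegative sequences *)

Lemma LimInf_nonneg_neq_0 (u : nat -> R) :
  (forall n, 0 <= u n) -> LimInf_seq u <> Finite 0 ->
  exists c, 0 < c /\ exists N, forall n, (N <= n)%nat -> c <= u n.
Proof.
  intros Hu Hne. unfold LimInf_seq in Hne.
  destruct (ex_LimInf_seq u) as [[l | | ] Hl]; simpl in Hne, Hl.
  - destruct (Rtotal_order l 0) as [Hneg | [-> | Hpos]].
    + assert (He : 0 < - l) by lra.
      destruct (proj1 (Hl (mkposreal _ He)) 0%nat) as [n [_ Hn]].
      simpl in Hn. specialize (Hu n). lra.
    + now elim Hne.
    + assert (He : 0 < l / 2) by lra.
      destruct (proj2 (Hl (mkposreal _ He))) as [N HN]. simpl in HN.
      exists (l / 2). split; [exact He|]. exists N. intros n Hn.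
      specialize (HN n Hn). lra.
  - destruct (Hl 1) as [N HN]. exists 1. split; [lra|]. exists N.
    intros n Hn. apply Rlt_le. now apply HN.
  - destruct (Hl 0 0%nat) as [n [_ Hn]]. specialize (Hu n). lra.
Qed.

Lemma strictly_increasing_ge_id (n : nat -> nat) :
  strictly_increasing n -> forall k, (k <= n k)%nat.
Proof.
  intros Hn. induction k as [|k IH]; [lia|]. specialize (Hn k). lia.
Qed.

(** * Orbits of power bounded operators *)

Lemma iter_scal {F : AbsRing} {X : NormedModule F} (T : X -> X) :
  is_linear T -> forall n a x,
  Nat.iter n T (scal a x) = scal a (Nat.iter n T x).
Proof.
  intros HT. induction n as [|n IH]; intros a x; simpl; [reflexivity|].
  rewrite IH. apply (linear_scal T HT).
Qed.

Lemma power_bounded_unit_ball {F : AbsRing} {X : NormedModule F} (T : X -> X) :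
  power_bounded T ->
  exists M, forall n x, norm x <= 1 -> norm (Nat.iter n T x) <= M.
Proof.
  unfold power_bounded. intros HT.
  exists (real (Sup_seq (fun n => op_norm (Nat.iter n T)))). intros n x Hx.
  assert (H : Rbar_le (norm (Nat.iter n T x))
                      (Sup_seq (fun n => op_norm (Nat.iter n T)))).
  { apply Sup_seq_minor_le with n.
    apply (proj1 (Lub_Rbar_correct _)). now exists x. }
  destruct (Sup_seq (fun n => op_norm (Nat.iter n T))); easy.
Qed.

Lemma power_bounded_orbit {F : AbsRing} {X : NormedModule F} (T : X -> X) :
  is_R_or_C F -> is_linear T -> power_bounded T ->
  forall y, exists M, forall n, norm (Nat.iter n T y) <= M.
Proof.
  intros HF HT Hpb y.
  destruct (power_bounded_unit_ball T Hpb) as [M HM].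
  pose proof (norm_ge_0 y) as Hy.
  assert (Hr : 0 < / (norm y + 1)) by (apply Rinv_0_lt_compat; lra).
  destruct (small_invertible_R_or_C F HF _ Hr) as [a [b [Hb Hab]]].
  exists (abs a * M). intros n.
  replace y with (scal a (scal b y)) by now rewrite scal_assoc, Hab, scal_one.
  rewrite (iter_scal T HT).
  eapply Rle_trans; [apply norm_scal|].
  apply Rmult_le_compat_l; [apply abs_ge_0|]. apply HM.
  eapply Rle_trans; [apply norm_scal|]. rewrite Hb.
  apply Rmult_le_reg_l with (norm y + 1); [lra|]. field_simplify; lra.
Qed.

(** * Weak limits and functionals *)

Lemma functional_scal {F : AbsRing} {X : NormedModule F} (f : X -> F) :
  is_functional f -> forall a x, f (scal a x) = mult a (f x).
Proof.
  intros Hf a x. exact (linear_scal _ Hf a x).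
Qed.

Lemma weak_cvg_abs {F : AbsRing} {X : NormedModule F} (u : nat -> X) (l : X)
    (f : X -> F) :
  weak_cvg u l -> is_functional f ->
  is_lim_seq (fun k => abs (f (u k))) (abs (f l)).
Proof.
  intros Hu Hf.
  exact (filterlim_comp _ _ _ _ _ _ _ _ (Hu f Hf)
           (@filterlim_norm F (AbsRing_NormedModule F) (f l))).
Qed.

Lemma type1_separates_points {F : AbsRing} {X : NormedModule F} :
  is_R_or_C F -> type1 X ->
  forall x : X, (forall g : X -> F, is_functional g -> g x = zero) -> x = zero.
Proof.
  intros HF H1 x Hx.
  assert (Hcv : norm_cvg (fun _ : nat => x) (opp x)).
  { apply H1. split.
    - intros g Hg. rewrite Hx by exact Hg.
      replace (g (opp x)) with (zero : F); [apply filterlim_const|].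
      replace (opp x) with (scal (opp one) x) by exact (scal_opp_one x).
      rewrite (functional_scal g Hg), (Hx g Hg).
      exact (eq_sym (mult_zero_r (opp one))).
    - rewrite norm_opp. apply is_lim_seq_const. }
  assert (Heq : x = opp x).
  { exact (filterlim_locally_unique _ _ _ (filterlim_const x) Hcv). }
  assert (H2 : scal (plus one one) x = zero).
  { rewrite scal_distr_r, scal_one. rewrite Heq at 2. exact (plus_opp_r x). }
  destruct (left_inverse_R_or_C F HF _ (two_neq_zero_R_or_C F HF)) as [h Hh].
  now rewrite <- (scal_one x), <- Hh, <- scal_assoc, H2, scal_zero_r.
Qed.

Lemma injective_functional_finite_dimensional {F : AbsRing} {X : NormedModule F}
    (f : X -> F) :
  is_R_or_C F -> is_functional f -> (exists x, f x <> zero) ->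
  (forall x, f x = zero -> x = zero) -> finite_dimensional X.
Proof.
  intros HF Hf [e He] Hinj.
  destruct (left_inverse_R_or_C F HF _ He) as [b Hb].
  exists 0%nat, (fun _ => e). intros x.
  exists (fun _ => mult (f x) b). rewrite sum_O.
  apply plus_reg_r with (opp (scal (mult (f x) b) e)). rewrite plus_opp_r.
  apply Hinj. rewrite <- scal_opp_l.
  rewrite (linear_plus _ Hf : forall u v, f (plus u v) = plus (f u) (f v)).
  rewrite (functional_scal f Hf), <- opp_mult_l, <- mult_assoc, Hb, mult_one_r.
  exact (plus_opp_r (f x)).
Qed.

(** An orbit that [f] keeps away from zero cannot be large for [g] compared to
    [f]; the ratio [|g| / |f|] is unchanged under scaling, so the scalar
    multiples of the orbit, and their weak limits, inherit the bound. *)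
Lemma functional_dominated {F : AbsRing} {X : NormedModule F} (T : X -> X)
    (y : X) (f : X -> F) (c M : R) (N : nat) :
  is_R_or_C F -> weakly_l_seq_supercyclic T y -> is_functional f ->
  (forall n, norm (Nat.iter n T y) <= M) ->
  0 < c -> (forall n, (N <= n)%nat -> c <= abs (f (Nat.iter n T y))) ->
  forall g : X -> F, is_functional g ->
  exists C, forall x, abs (g x) <= C * abs (f x).
Proof.
  intros HF [_ Hy] Hf HM Hc HN g Hg.
  destruct (linear_norm _ Hg) as [K [HK HgK]].
  exists (K * M / c). intros x.
  destruct (Hy x) as [alpha [n [_ [Hn Hcv]]]].
  set (u := fun k => scal (alpha k) (Nat.iter (n k) T y)) in Hcv.
  assert (Hle : Rbar_le (abs (g x)) (K * M / c * abs (f x))).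
  2: exact Hle.
  apply (is_lim_seq_le_loc (fun k => abs (g (u k)))
           (fun k => K * M / c * abs (f (u k)))).
  - exists N. intros k Hk. unfold u.
    rewrite (functional_scal g Hg), (functional_scal f Hf).
    rewrite !(abs_mult_R_or_C F HF).
    set (z := Nat.iter (n k) T y).
    assert (Hz : c <= abs (f z)).
    { apply HN. pose proof (strictly_increasing_ge_id n Hn k). lia. }
    assert (HzM : norm z <= M) by apply HM.
    assert (Hgz : abs (g z) <= K * norm z) by exact (HgK z).
    replace (K * M / c * (abs (alpha k) * abs (f z)))
      with (abs (alpha k) * (K * M / c * abs (f z))) by ring.
    apply Rmult_le_compat_l; [apply abs_ge_0|].
    assert (0 <= M) by (pose proof (norm_ge_0 z); lra).
    apply Rle_trans with (K * M / c * c).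
    + replace (K * M / c * c) with (K * M) by (field; lra). nra.
    + apply Rmult_le_compat_l; [|exact Hz].
      apply Rmult_le_pos; [nra|]. apply Rlt_le. now apply Rinv_0_lt_compat.
  - now apply weak_cvg_abs.
  - apply (is_lim_seq_scal_l (fun k => abs (f (u k))) _ (abs (f x))).
    now apply weak_cvg_abs.
Qed.

(** * Supercyclic orbits *)

Lemma supercyclic_LimInf_functional {F : AbsRing} {X : NormedModule F}
    (T : X -> X) (y : X) (f : X -> F) :
  is_R_or_C F -> infinite_dimensional X -> type1 X ->
  is_linear T -> power_bounded T -> weakly_l_seq_supercyclic T y ->
  is_functional f -> (exists x, f x <> zero) ->
  LimInf_seq (fun n => abs (f (Nat.iter n T y))) = Finite 0.
Proof.
  intros HF Hinf H1 HT Hpb Hy Hf Hnz.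
  destruct (Rbar_eq_dec (LimInf_seq (fun n => abs (f (Nat.iter n T y)))) 0)
    as [H | Hne]; [exact H|].
  exfalso. apply Hinf.
  apply (injective_functional_finite_dimensional f HF Hf Hnz).
  intros x Hx. apply (type1_separates_points HF H1). intros g Hg.
  apply LimInf_nonneg_neq_0 in Hne; [|intros n; apply abs_ge_0].
  destruct Hne as [c [Hc [N HN]]].
  destruct (power_bounded_orbit T HF HT Hpb y) as [M HM].
  destruct (functional_dominated T y f c M N HF Hy Hf HM Hc HN g Hg) as [C HC].
  specialize (HC x). rewrite Hx, abs_zero, Rmult_0_r in HC.
  apply abs_eq_zero. pose proof (abs_ge_0 (g x)). lra.
Qed.

Theorem theorem6p1 :
  forall (F : AbsRing) (X : NormedModule F) (T : X -> X),
  is_R_or_C F ->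
  infinite_dimensional X ->
  type1 X ->
  is_linear T ->
  power_bounded T ->
  (forall x : X, x <> zero -> ~ weak_cvg (fun n => Nat.iter n T x) zero) ->
  (~ exists y : X, weakly_l_seq_supercyclic T y)
  \/
  (forall y : X, weakly_l_seq_supercyclic T y ->
   forall f : X -> F, is_functional f ->
   (exists x : X, f x <> zero) ->
   ~ filterlim (fun n => f (Nat.iter n T y)) eventually (locally (zero : F)) ->
   LimInf_seq (fun n => abs (f (Nat.iter n T y))) = Finite 0
   \/
   exists n : nat -> nat, strictly_increasing n /\
     Rbar_lt (LimSup_seq (fun k => abs (f (Nat.iter (n k) T y))))
             (Rbar_mult (dual_norm f)
                        (LimSup_seq (fun k => norm (Nat.iter (n k) T y))))).
Proof.
  intros F X T HF Hinf H1 HT Hpb _. right. intros y Hy f Hf Hnz _. left.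
  now apply supercyclic_LimInf_functional.
Qed.
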